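(* Let $m,n$ be positive integers with $m<n$ and $m$ even, and let $G$ be a connected finite simple graph with maximum degree $\Delta(G)\ge 4$. Then $\chi(G^{\frac{m}{n}})=\omega(G^{\frac{m}{n}})$.
   Context: For a graph $G$ and positive integer $n$, the $n$-subdivision $G^{\frac{1}{n}}$ is obtained from $G$ by replacing each edge with a path of length $n$. For a graph $H$ and positive integer $m$, the $m$-th power $H^m$ is the graph on $V(H)$ in which two distinct vertices are adjacent iff their distance in $H$ is at most $m$. The fractional power is $G^{\frac{m}{n}}=(G^{\frac{1}{n}})^m$. $\chi$ denotes the chromatic number and $\omega$ the clique number. *)

(* Defs.v *)
From mathcomp Require Import all_boot.

Set Implicit Arguments.
Unset Strict Implicit.
Unset Printing Implicit Defensive.

Record sgraph := SGraph {
  vertex :> finType;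
  adj : rel vertex;
  adj_sym : symmetric adj;
  adj_irrefl : irreflexive adj }.

Section Invariants.
Variable G : sgraph.

Definition connected : Prop := forall x y : G, connect (@adj G) x y.

Definition degree (x : G) : nat := #|[set y | adj x y]|.

Definition max_degree : nat := \max_(x : G) degree x.

Definition clique (A : {set G}) : bool :=
  [forall x in A, forall y in A, (x != y) ==> adj x y].

Definition clique_number : nat := \max_(A : {set G} | clique A) #|A|.

Definition colorable (k : nat) : bool :=
  [exists f : {ffun G -> 'I_k}, forall x, forall y, adj x y ==> (f x != f y)].

Lemma colorable_ex : exists k, colorable k.
Proof.
exists #|G|; apply/existsP; exists [ffun x => enum_rank x].
apply/forallP=> x; apply/forallP=> y; apply/implyP=> xy; rewrite !ffunE.
by apply: contraTneq xy => /enum_rank_inj->; rewrite adj_irrefl.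
Qed.

Definition chromatic_number : nat := ex_minn colorable_ex.

Definition walk (k : nat) (x y : G) : bool :=
  [exists p : k.-tuple G, path (@adj G) x p && (last x p == y)].

(* The least length of a walk from x to y, or None if there is no walk;        *)
(* lengths below #|G| suffice, since a shortest walk has no repeated vertex.   *)
Definition dist (x y : G) : option nat :=
  ohead [seq k <- iota 0 #|G| | walk k x y].

End Invariants.

Section Power.
Variables (H : sgraph) (m : nat).

Definition power_adj : rel H :=
  fun x y => (x != y) && (if dist x y is Some d then d <= m else false).

Lemma walk_sym k : symmetric (@walk H k).
Proof.
suff imp : forall x y : H, walk k x y -> walk k y x
  by move=> x y; apply/idP/idP; apply: imp.
move=> x y /existsP[p /andP[xp /eqP <-]].
have sz : size (rev (belast x p)) == k by rewrite size_rev size_belast size_tuple.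
apply/existsP; exists (Tuple sz) => /=.
rewrite rev_path (eq_path (e' := @adj H)) => [|u v]; last exact: adj_sym.
rewrite xp /=; case: (tval p) => //= z s.
by rewrite rev_cons last_rcons.
Qed.

Lemma power_adj_sym : symmetric power_adj.
Proof.
move=> x y; rewrite /power_adj /dist eq_sym.
by under eq_filter do rewrite walk_sym.
Qed.

Lemma power_adj_irrefl : irreflexive power_adj.
Proof. by move=> x; rewrite /power_adj eqxx. Qed.

Definition power : sgraph := SGraph power_adj_sym power_adj_irrefl.

End Power.

Section Subdivision.
Variables (G : sgraph) (n : nat).

(* Each edge {u, v} is represented once, by the ordered pair in which u comes  *)
(* before v in the enumeration of G.                                           *)
Definition edge : finType :=
  {uv : G * G | adj uv.1 uv.2 && (enum_rank uv.1 < enum_rank uv.2)}.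

Definition subdiv_vertex : finType := (G + edge * 'I_n.-1)%type.

(* The k-th vertex, 0 <= k <= n, of the path of length n that replaces the     *)
(* edge uv: u for k = 0, v for k = n, and the inner vertex (uv, k - 1) for     *)
(* 0 < k < n.                                                                  *)
Definition path_vertex (uv : edge) (k : nat) : subdiv_vertex :=
  if k is j.+1 then
    if insub j is Some i then inr (uv, i) else inl (val uv).2
  else inl (val uv).1.

Definition subdiv_adj : rel subdiv_vertex := fun x y =>
  [exists uv : edge, exists k : 'I_n,
     ((x == path_vertex uv k) && (y == path_vertex uv k.+1))
  || ((y == path_vertex uv k) && (x == path_vertex uv k.+1))].

Lemma subdiv_adj_sym : symmetric subdiv_adj.
Proof.
by move=> x y; apply: eq_existsb => uv; apply: eq_existsb => k; rewrite orbC.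
Qed.

Lemma path_vertex_neq uv (k : 'I_n) : path_vertex uv k != path_vertex uv k.+1.
Proof.
case: k => -[|k] /= kn.
  case: insubP => //= _; apply/eqP=> -[uvE].
  by have /andP[_] := valP uv; rewrite -uvE ltnn.
have kn1 : k < n.-1 by case: n kn.
rewrite (insubT (fun i => i < n.-1) kn1).
case: insubP => //= i _ iE; apply/eqP=> -[/(congr1 val)] /= kE.
by move: iE; rewrite -kE => /eqP; rewrite ltn_eqF.
Qed.

Lemma subdiv_adj_irrefl : irreflexive subdiv_adj.
Proof.
move=> x; apply/negbTE/existsPn=> uv; apply/existsPn=> k; rewrite orbb.
apply/andP=> -[/eqP xk /eqP xk1].
by have := path_vertex_neq uv k; rewrite -xk -xk1 eqxx.
Qed.

Definition subdivision : sgraph := SGraph subdiv_adj_sym subdiv_adj_irrefl.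

End Subdivision.

Definition fractional_power (G : sgraph) (m n : nat) : sgraph :=
  power (subdivision G n) m.

(* Main.v *)
(** Put k = m/2 and D = Delta(G).  A ball of radius k around a vertex of maximum
    degree is a clique with Dk + 1 vertices, so a colouring with Dk + 1 colours
    suffices: a colour 0 and colours (g, j) with g < D and 1 <= j <= k.

    Half-edges are first coloured with D colours so that the half-edges at a
    vertex, as well as the two halves of an edge, get distinct colours (this is
    Koenig's theorem for the 1-subdivision of G).  Branch vertices get colour 0,
    and the vertex at distance j <= k from u on a half-edge of colour a at u gets
    (a, j).  If the two halves of an edge have colours a and b and n <= 4k + 1,
    pick g and d so that a, b, g, d are distinct (here D >= 4 is used) and colour
    the path
      0, (a,1), ..., (a,k), (g,k), (g,k-1), ..., (d,k-1), (d,k), (b,k), ..., (b,1), 0;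
    near its ends (g,j) and (d,j) are more than 2k away from the vertices of the
    same colour on other edges.  Longer paths are obtained by inserting periods of
    length 2k + 1. *)

Require Import Defs.
From mathcomp Require Import all_boot fingroup perm zify.

Set Implicit Arguments.
Unset Strict Implicit.
Unset Printing Implicit Defensive.

(** * Half-edge colourings by Kempe changes *)

Lemma connect_last (T : finType) (e : rel T) x y :
  connect e x y -> y = x \/ exists2 z, connect e x z & e z y.
Proof.
case/connectP=> p; case/lastP: p => [|p z]; first by move=> _ ->; left.
rewrite rcons_path last_rcons => /andP[xp zy] ->; right.
by exists (last x p) => //; apply/connectP; exists p.
Qed.

Section HalfEdgeColoring.
Variables (G : sgraph) (D : nat).
Implicit Type c : G -> G -> 'I_D.

Definition proper_at_vertices c := forall x, {in [pred y | adj x y] &, injective (c x)}.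

Definition bad_edges c : {set G * G} :=
  [set xy | adj xy.1 xy.2 && (c xy.1 xy.2 == c xy.2 xy.1)].

(* Kempe change: a and b are exchanged at every vertex reached from u by       *)
(* leaving along the b-coloured half-edge as long as the other half of that    *)
(* edge is coloured a.  No vertex reaches v this way, since the a-coloured     *)
(* half-edge at v belongs to uv.                                               *)
Lemma bad_edges_decr c u v : 1 < D -> proper_at_vertices c ->
  (u, v) \in bad_edges c ->
  exists2 c', proper_at_vertices c' & bad_edges c' \proper bad_edges c.
Proof.
move=> D_gt1 cP; rewrite inE /= => /andP[uv /eqP cuv].
have [b bNa] : exists b : 'I_D, b != c u v.
  have [a0|a0] := eqVneq (val (c u v)) 0.
    by exists (Ordinal D_gt1); apply/eqP=> /(congr1 val) /=; rewrite a0.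
  by exists (Ordinal (ltnW D_gt1)); apply: contraNneq a0 => <-.
set a := c u v in cuv bNa *.
pose e : rel G := fun x y => [&& adj x y, c x y == b & c y x == a].
pose P := connect e u.
pose c' x y := if P x then tperm a b (c x y) else c x y.
have Pu : P u by apply: connect0.
have prevP x y : P x -> adj x y -> c x y = a -> c y x = b -> P y.
  (* At [x = u] this forces [y = v], whose half has colour [a], not [b]; any other [x] was entered
     through its [a]-coloured half-edge, so [y] is its predecessor. *)
  move=> Px xy cxy cyx; case: (connect_last Px) => [xu|[z Pz /and3P[zx _ /eqP cxz]]].
    rewrite {x Px}xu in xy cxy cyx.
    have yv : y = v by apply: (cP u); rewrite ?inE.
    by move: cyx bNa; rewrite yv -cuv => ->; rewrite eqxx.
  suff -> : y = z by [].
  by apply: (cP x); rewrite ?inE ?cxz // adj_sym.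
have nextP x y : P x -> adj x y -> c x y = b -> c y x = a -> P y.
  move=> Px xy cxy cyx; apply: connect_trans Px (connect1 _).
  by rewrite /e xy cxy cyx !eqxx.
(* A new conflict needs halves coloured [a] and [b]; [prevP] and [nextP] then put [y] in [P]. *)
have mixed x y : P x -> ~~ P y -> adj x y ->
    c' x y = c' y x -> c x y = c y x.
  move=> Px Py xy; rewrite /c' Px (negbTE Py).
  case: tpermP => // [ca /esym cb|cb /esym ca].
    by rewrite (prevP x y) in Py.
  by rewrite (nextP x y) in Py.
have Pv : ~~ P v.
  apply/negP=> /connect_last[vu|[z Pz /and3P[zv /eqP czv /eqP cvz]]].
    by rewrite vu adj_irrefl in uv.
  have zu : z = u by apply: (cP v); rewrite ?inE 1?adj_sym // cvz.
  by move: bNa; rewrite -czv zu eqxx.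
exists c' => [x y z xy xz|].
  by rewrite /c'; case: ifP => _ => [/perm_inj|]; apply: cP.
apply/properP; split; last first.
  exists (u, v); first by rewrite inE uv -cuv eqxx.
  rewrite inE uv /= /c' Pu (negbTE Pv) -/a -cuv tpermL.
  exact: bNa.
apply/subsetP=> -[x y]; rewrite !inE /= => /andP[xy /eqP cxy]; rewrite xy /=.
apply/eqP; case: (boolP (P x)) (boolP (P y)) => Px [] Py.
- by apply: (@perm_inj _ (tperm a b)); move: cxy; rewrite /c' Px Py.
- exact: mixed.
- by apply/esym/mixed; rewrite // adj_sym.
- by move: cxy; rewrite /c' (negbTE Px) (negbTE Py).
Qed.

Lemma half_edge_coloring : 1 < D -> (forall x : G, degree x <= D) ->
  exists2 c, proper_at_vertices c & forall x y, adj x y -> c x y != c y x.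
Proof.
move=> D_gt1 degD.
have [c0 c0P] : exists c, proper_at_vertices c.
  pose i0 := Ordinal (ltnW D_gt1).
  (* Start by numbering the neighbours of each vertex; the default [i0] never occurs on adjacent
     pairs. *)
  exists (fun x y => insubd i0 (index y (enum [set z | adj x z]))) => x y z.
  rewrite !inE => xy xz.
  have idx t : adj x t -> index t (enum [set z | adj x z]) < D.
    move=> xt; apply: leq_trans (degD x).
    by rewrite /degree cardE index_mem mem_enum inE.
  move=> /(congr1 val); rewrite !val_insubd !idx // => /(index_inj x).
  by apply; rewrite ?mem_enum ?inE.
have [N] := ubnP #|bad_edges c0|; elim: N c0 c0P => // N IH c cP cN.
have [bad0|[[u v] uv]] := set_0Vmem (bad_edges c).
  exists c => // x y xy; apply/negP=> cxy.
  by have := in_set0 (x, y); rewrite -bad0 inE xy cxy.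
have [c' c'P /proper_card lt] := bad_edges_decr D_gt1 cP uv.
by apply: IH c'P _; lia.
Qed.

End HalfEdgeColoring.

(** * Colour words along a subdivided edge *)

Section Words.
Variables (k D : nat).
Implicit Types (x : nat -> nat * nat).

Definition valid_color (p : nat * nat) : bool :=
  (p == (0, 0)) || (p.1 < D) && (0 < p.2 <= k).

(* The path colouring of an edge with half-edge colours a and b is a word x     *)
(* with x 0 = x n = (0, 0), where (0, 0) stands for colour 0.  The last clause  *)
(* keeps the i-th vertex apart from the j-th vertex of a half-edge with the     *)
(* same origin and colour g.                                                    *)
Definition starts_with a x : Prop :=
  [/\ x 0 = (0, 0),
      forall i, 0 < i <= k -> x i = (a, i) &
      forall i g j, 0 < j -> i + j <= k.*2 -> g <> a -> x i <> (g, j)].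

Definition good_word n a b x : Prop :=
  [/\ starts_with a x,
      starts_with b (fun i => x (n - i)),
      forall i, i <= n -> valid_color (x i) &
      forall i j, i < j <= n -> j - i <= k.*2 -> x i <> x j].

Lemma fresh_colors (s : seq nat) : size s < D -> exists2 g, g < D & g \notin s.
Proof.
move=> sD; have [/allPn[g]|] := boolP (~~ all [in s] (iota 0 D)).
  by rewrite mem_iota => gD gs; exists g.
rewrite negbK => /allP /(uniq_leq_size (iota_uniq 0 D)).
by rewrite size_iota leqNgt sD.
Qed.

(* The windows of 2k+1 consecutive letters of 0,...,2k,0,...,n are rotations   *)
(* of windows of the old word, and both ends are unchanged.                    *)
Lemma good_word_ext n a b x : k.*2 < n -> good_word n a b x ->
  good_word (n + k.*2.+1) a b
    (fun i => if i <= k.*2 then x i else x (i - k.*2.+1)).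
Proof.
move=> kn [[x0 xl xf] [y0 yl yf] xv xd].
have tail i : i <= k.*2 ->
    (if n + k.*2.+1 - i <= k.*2 then x (n + k.*2.+1 - i)
     else x (n + k.*2.+1 - i - k.*2.+1)) = x (n - i).
  by move=> ik; case: ifP => [|_]; [lia | congr x; lia].
split.
- split=> [|i ik|i g j j0 ij ga]; rewrite ?x0 //.
    by rewrite ifT; [apply: xl | lia].
  by rewrite ifT; [apply: xf | lia].
- split=> [|i ik|i g j j0 ij ga].
  + by rewrite tail // y0.
  + by rewrite tail ?yl //; lia.
  + by rewrite tail; [apply: yf | lia].
- by move=> i ni; case: ifP => ik; apply: xv; lia.
move=> i j ij d; case: (leqP i k.*2) => ik; case: (leqP j k.*2) => jk.
- by apply: xd; lia.
- by apply/nesym/xd; lia.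
- by lia.
- by apply: xd; lia.
Qed.

Lemma good_word_base r a b g d : 0 < k -> r <= k.*2 ->
  [/\ a < D, b < D, g < D & d < D] ->
  a <> b -> g <> a -> g <> b -> d <> a -> d <> b -> d <> g ->
  exists x, good_word (k.*2.+1 + r) a b x.
Proof.
move=> k0 rk [aD bD gD dD] ab ga gb da db dg; set n := k.*2.+1 + r.
(* Of the r middle letters, the first half has colour [g], the rest [d]. Position and second
   component of a [g]-letter add up to 2k+1, as they do for a [d]-letter counted from the other end;
   changing colour halfway makes the sum exceed 2k from the opposite ends too. *)
exists (fun p => if p == 0 then (0, 0) else if p <= k then (a, p)
  else if p <= k + uphalf r then (g, k.*2.+1 - p)
  else if p <= k + r then (d, k.*2.+1 - (n - p))
  else if p < n then (b, n - p) else (0, 0)).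
have r2 : r <= (uphalf r).*2 <= r.+1 by lia.
move: (uphalf r) r2 => h r2; rewrite {}/n.
split.
- split=> [//|i ik|i e j j0 ij ea]; first by rewrite ifF ?ifT //; lia.
  by repeat case: ifP => ?; first [lia | move=> [] *; lia].
- split=> [|i ik|i e j j0 ij ea]; rewrite /=.
  + by repeat case: ifP => ?; [lia..|].
  + by repeat case: ifP => ?; first [lia | congr pair; lia].
  + by repeat case: ifP => ?; move=> [??]; lia.
- move=> i ni; rewrite /valid_color.
  by repeat case: ifP => ? /=; rewrite ?xpair_eqE /=; lia.
- move=> i j ij dij.
  by repeat case: ifP => ?; first [lia | move=> [] *; lia].
Qed.

(** Lengths 2k+1 to 4k+1 are base words; from a longer one a period 2k+1 can be removed, leaving a
    length still above 2k. *)
Lemma good_word_exists n a b : 0 < k -> 3 < D -> k.*2 < n ->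
  a < D -> b < D -> a <> b -> exists x, good_word n a b x.
Proof.
move=> k0 D4 kn aD bD ab.
have [g gD] : exists2 g, g < D & g \notin [:: a; b] by apply: fresh_colors => /=; lia.
have [d dD] : exists2 d, d < D & d \notin [:: g; a; b] by apply: fresh_colors.
rewrite !inE !negb_or => /and3P[/eqP dg /eqP da /eqP db] /andP[/eqP ga /eqP gb].
have [N] := ubnP n; elim: N n kn => // N IH n kn nN.
case: (leqP n (k.*2 + k.*2.+1)) => nk.
  have -> : n = k.*2.+1 + (n - k.*2.+1) by lia.
  by apply: (@good_word_base _ a b g d); rewrite //; lia.
case: (IH (n - k.*2.+1)) => [||x xP]; try lia.
have -> : n = n - k.*2.+1 + k.*2.+1 by lia.
by exists (fun i => if i <= k.*2 then x i else x (i - k.*2.+1)); apply: good_word_ext; first lia.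
Qed.

End Words.

Section WordSymmetry.
Variables (k D n a b : nat) (x y : nat -> nat * nat).
Hypotheses (lt_kn : k.*2 < n) (xP : good_word k D n a b x).

Lemma eq_good_word : (forall i, i <= n -> y i = x i) -> good_word k D n a b y.
Proof.
case: xP => [[x0 xl xf] [z0 zl zf] xv xd] yx; split.
- split=> [|i ik|i g j j0 ij ga]; rewrite yx; try lia; [exact: x0 | exact: xl | exact: xf].
- split=> [|i ik|i g j j0 ij ga]; rewrite yx; try lia; [exact: z0 | exact: zl | exact: zf].
- by move=> i ni; rewrite yx //; apply: xv.
- by move=> i j ij dij; rewrite !yx; [apply: xd|lia..].
Qed.

(** Words are chosen for one orientation of each edge; this serves the other. *)
Lemma rev_good_word : (forall i, i <= n -> y i = x (n - i)) -> good_word k D n b a y.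
Proof.
case: xP => [[x0 xl xf] [z0 zl zf] xv xd] yx; split.
- split=> [|i ik|i g j j0 ij ga]; rewrite yx; try lia; [exact: z0 | exact: zl | exact: zf].
- split=> [|i ik|i g j j0 ij ga]; rewrite yx ?subKn; try lia; [exact: x0 | exact: xl | exact: xf].
- by move=> i ni; rewrite yx //; apply: xv; lia.
- by move=> i j ij dij; rewrite !yx; [apply/nesym/xd; lia|lia..].
Qed.

End WordSymmetry.

(** * Numbering the valid colours from 0 to Dk *)

Definition color_code k (p : nat * nat) := p.1 * k + p.2.

Lemma color_code_lt k D p : valid_color k D p -> color_code k p < (D * k).+1.
Proof.
case/predU1P=> [->|/andP[pD /andP[_ pk]]]; first by rewrite /color_code mul0n.
by rewrite ltnS /color_code; apply: leq_trans (leq_mul pD (leqnn k)); rewrite mulSn addnC leq_add.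
Qed.

(** Only (0, 0) has code 0; the code of (g, j) minus 1 has quotient g and remainder j - 1 modulo
    k. *)
Lemma color_code_inj k D : {in valid_color k D &, injective (color_code k)}.
Proof.
have code_gt0 p : 0 < p.2 -> 0 < color_code k p by rewrite /color_code; lia.
have code_pred p : 0 < p.2 <= k -> (color_code k p).-1 = p.1 * k + p.2.-1 /\ p.2.-1 < k.
  by move=> /andP[]; rewrite /color_code; case: p.2 => // j _ jk; rewrite addnS.
move=> p q /predU1P[->|/andP[_ pk]] /predU1P[->|/andP[_ qk]] // pq.
- by have := code_gt0 q; rewrite -pq; case/andP: qk => ->; rewrite /color_code mul0n => _ /(_ isT).
- by have := code_gt0 p; rewrite pq; case/andP: pk => ->; rewrite /color_code mul0n => _ /(_ isT).
have [pE p2] := code_pred p pk; have [qE q2] := code_pred q qk.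
have k0 : 0 < k by lia.
move: pE; rewrite pq qE => E; have := congr1 (divn^~ k) E; have := congr1 (modn^~ k) E.
rewrite !modnMDl !divnMDl // !modn_small // !divn_small // !addn0.
by case: p q pk qk {pq p2 q2 qE E} => [p1 p2] [q1 q2] /= ? ? ? ->; congr pair; lia.
Qed.

(** * Oriented paths and short walks in the subdivision *)

Section DartPaths.
Variables (G : sgraph) (n : nat).
Hypothesis n_gt0 : 0 < n.
Local Notation H := (subdivision G n).

(* The i-th vertex on the path replacing uv, counted from u; junk if u and v   *)
(* are not adjacent.                                                           *)
Definition dart_vertex (u v : G) (i : nat) : H :=
  if insub (u, v) is Some e then path_vertex n e i
  else if insub (v, u) is Some e then path_vertex n e (n - i)
  else inl u.

Lemma path_vertex_inner (e : edge G) i (lt_in : i < n.-1) :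
  path_vertex n e i.+1 = inr (e, Ordinal lt_in).
Proof. by rewrite /= insubT. Qed.

Lemma path_vertex_last (e : edge G) : path_vertex n e n = inl (val e).2.
Proof. by case: n n_gt0 => // n' _ /=; rewrite insubF ?ltnn. Qed.

Variant path_vertex_spec (e : edge G) i : H -> Prop :=
  | PathStart of i = 0 : path_vertex_spec e i (inl (val e).1)
  | PathInner (j : 'I_n.-1) of i = j.+1 : path_vertex_spec e i (inr (e, j))
  | PathEnd of i = n : path_vertex_spec e i (inl (val e).2).

Lemma path_vertexP (e : edge G) i : i <= n -> path_vertex_spec e i (path_vertex n e i).
Proof.
case: i => [|i] lt_in; first by constructor.
have [lt_in1|ge_in] := ltnP i n.-1.
  by rewrite path_vertex_inner; constructor.
have -> : i.+1 = n by lia.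
by rewrite path_vertex_last; constructor.
Qed.

Lemma edge_asym (e f : edge G) : val e <> ((val f).2, (val f).1).
Proof.
move=> ef; have /andP[_] := valP e; have /andP[_] := valP f.
by rewrite ef /= => h1 h2; have := ltn_trans h1 h2; rewrite ltnn.
Qed.

Lemma dart_vertexE (e : edge G) i :
  dart_vertex (val e).1 (val e).2 i = path_vertex n e i.
Proof. by rewrite /dart_vertex -surjective_pairing valK. Qed.

Lemma dart_vertexNE (e : edge G) i :
  dart_vertex (val e).2 (val e).1 i = path_vertex n e (n - i).
Proof.
rewrite /dart_vertex -[((val e).1, _)]surjective_pairing valK.
by case: insubP => // f _ /edge_asym.
Qed.

Lemma adj_edge (u v : G) : adj u v -> exists e : edge G,
  (u, v) = ((val e).1, (val e).2) \/ (u, v) = ((val e).2, (val e).1).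
Proof.
move=> uv; have [lt|gt|/ord_inj/enum_rank_inj eq_uv] := ltngtP (enum_rank u) (enum_rank v).
- have uvP : adj (u, v).1 (u, v).2 && (enum_rank (u, v).1 < enum_rank (u, v).2).
    by rewrite uv.
  by exists (exist _ (u, v) uvP : edge G); left.
- have vuP : adj (v, u).1 (v, u).2 && (enum_rank (v, u).1 < enum_rank (v, u).2).
    by rewrite adj_sym uv.
  by exists (exist _ (v, u) vuP : edge G); right.
by rewrite eq_uv adj_irrefl in uv.
Qed.

Lemma dart_vertex0 (u v : G) : adj u v -> dart_vertex u v 0 = inl u.
Proof.
case/adj_edge=> e [[-> ->]|[-> ->]]; rewrite ?dart_vertexE ?dart_vertexNE //.
by rewrite subn0 path_vertex_last.
Qed.

Lemma dart_vertex_rev (u v : G) i : adj u v -> i <= n ->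
  dart_vertex v u i = dart_vertex u v (n - i).
Proof.
case/adj_edge=> e [[-> ->]|[-> ->]] ni; rewrite dart_vertexE dart_vertexNE //.
by rewrite subKn.
Qed.

Lemma dart_vertex_last (u v : G) : adj u v -> dart_vertex u v n = inl v.
Proof. by move=> uv; rewrite dart_vertex_rev 1?adj_sym // subnn dart_vertex0 // adj_sym. Qed.

Lemma dart_vertex_inl (u v w : G) i : adj u v -> i <= n ->
  dart_vertex u v i = inl w -> i = 0 /\ w = u \/ i = n /\ w = v.
Proof.
case/adj_edge=> e [[-> ->]|[-> ->]] ni; rewrite ?dart_vertexE ?dart_vertexNE.
  by case: (path_vertexP e ni) => // -> [<-]; auto.
have ni' : n - i <= n by lia.
by case: (path_vertexP e ni') => // ? [<-]; [right | left]; split=> //; lia.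
Qed.

Lemma dart_vertex_inner_inj (u v a b : G) i j :
  adj u v -> adj a b -> 0 < i < n -> j <= n ->
  dart_vertex u v i = dart_vertex a b j ->
  [/\ a = u, b = v & j = i] \/ [/\ a = v, b = u & j = n - i].
Proof.
move=> /adj_edge[e E] /adj_edge[f F] /andP[i0 ni] nj.
have ni1 : i <= n by lia.
have ni2 : n - i <= n by lia.
have nj2 : n - j <= n by lia.
case: E => -[-> ->]; case: F => -[-> ->]; rewrite ?dart_vertexE ?dart_vertexNE.
- case: (path_vertexP e ni1) => [|s si|]; try lia.
  by case: (path_vertexP f nj) => // t tj [-> st]; left; split; rewrite // si st.
- case: (path_vertexP e ni1) => [|s si|]; try lia.
  by case: (path_vertexP f nj2) => // t tj [-> st]; right; split; rewrite // si st; lia.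
- case: (path_vertexP e ni2) => [|s si|]; try lia.
  by case: (path_vertexP f nj) => // t tj [-> st]; right; split; rewrite // si st.
case: (path_vertexP e ni2) => [|s si|]; try lia.
by case: (path_vertexP f nj2) => // t tj [-> st]; left; split=> //; move: si tj; rewrite st; lia.
Qed.

Lemma subdiv_adj_dart (x y : H) : adj x y -> exists u v i,
  [/\ adj u v, i < n, x = dart_vertex u v i & y = dart_vertex u v i.+1].
Proof.
case/existsP=> e /existsP[i]; have /andP[e_adj _] := valP e.
case/orP=> /andP[/eqP -> /eqP ->].
  by exists (val e).1, (val e).2, i; rewrite !dart_vertexE.
exists (val e).2, (val e).1, (n - i.+1); have lt_in := ltn_ord i.
rewrite !dart_vertexNE adj_sym; split=> //; first lia.
  by congr path_vertex; lia.
by congr path_vertex; lia.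
Qed.

Lemma dart_subdiv_adj (u v : G) i : adj u v -> i < n ->
  adj (dart_vertex u v i) (dart_vertex u v i.+1).
Proof.
move=> /adj_edge[e E] lt_in; case: E => -[-> ->]; rewrite ?dart_vertexE ?dart_vertexNE.
  by apply/existsP; exists e; apply/existsP; exists (Ordinal lt_in); rewrite !eqxx.
have lt_in2 : n - i.+1 < n by lia.
apply/existsP; exists e; apply/existsP; exists (Ordinal lt_in2).
by rewrite [nat_of_ord _]/= subnSK // !eqxx orbT.
Qed.

(* Up to length n - 1 a walk passes through at most one branch vertex, or      *)
(* returns to where it was.                                                    *)
Definition near l (x y : H) : Prop := exists u v w i j,
  [/\ adj u v, adj u w, (i <= n) && (j <= n),
      x = dart_vertex u v i /\ y = dart_vertex u w j &
      v = w /\ (i <= j + l) && (j <= i + l) \/ i + j <= l].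

Lemma near_adj (x y : H) : adj x y -> near 1 x y.
Proof.
case/subdiv_adj_dart=> u [v [i [uv lt_in xE yE]]].
by exists u, v, v, i, i.+1; split=> //; [lia | left; split=> //; lia].
Qed.

Lemma near_step l (x y z : H) : l.+1 < n -> near l x y -> adj y z -> near l.+1 x z.
Proof.
move=> ln [u [v [w [i [j [uv uw /andP[ni nj] [xE yE] ij]]]]]].
case/subdiv_adj_dart=> a [b [t [ab tn yE' zE]]].
have [j0|j0] := posnP j.
  have /(dart_vertex_inl ab (ltnW tn)) : dart_vertex a b t = inl u.
    by rewrite -yE' yE j0 dart_vertex0.
  case=> -[tE uE]; last by rewrite tE ltnn in tn.
  subst a t; exists u, v, b, i, 1; split=> //; first lia.
  (* With [j = 0], both alternatives give [i <= l], so the walk may leave [u] along any edge. *)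
  by right; case: ij; lia.
have [jn|jn] := eqVneq j n.
  have /(dart_vertex_inl ab (ltnW tn)) : dart_vertex a b t = inl w.
    by rewrite -yE' yE jn dart_vertex_last.
  case=> -[tE wE]; last by rewrite tE ltnn in tn.
  (* As [j = n > l], both vertices lie on one path; it is recentred at [w], where x has position
     [n - i <= l]. *)
  case: ij => [[vw ij]|]; last lia.
  subst a t v; exists w, u, b, (n - i), 1; split=> //; [|lia| |lia].
    by rewrite adj_sym.
  by rewrite xE dart_vertex_rev 1?adj_sym.
have j_in : 0 < j < n by lia.
have := dart_vertex_inner_inj uw ab j_in (ltnW tn) (etrans (esym yE) yE').
case=> -[aE bE tE].
  subst a b t; exists u, v, w, i, j.+1; split=> //; first lia.
  by case: ij => [[vw ij]|ij]; [left; split=> //; lia | right; lia].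
exists u, v, w, i, j.-1; split=> //; first lia.
  by split; rewrite // zE aE bE dart_vertex_rev //; congr dart_vertex; lia.
by case: ij => [[vw ij]|ij]; [left; split=> //; lia | right; lia].
Qed.

Lemma near_path (x : H) p : path (@adj H) x p -> 0 < size p < n ->
  near (size p) x (last x p).
Proof.
elim/last_ind: p => // p z IH; rewrite rcons_path last_rcons size_rcons.
move=> /andP[xp yz] lt_pn; case: p => [|y p] in IH xp yz lt_pn *.
  exact: near_adj.
by apply: near_step yz => //; apply: IH => //; rewrite /= in lt_pn *; lia.
Qed.

End DartPaths.

(** * Distances in terms of walks *)

Section Power.
Variables (H : sgraph) (m : nat).

Definition within l (x y : H) : Prop :=
  exists p, [/\ path (@adj H) x p, last x p = y & size p <= l].

(** A walk shortens to one without repeated vertices, whose length is below [#|H|] and hence listed;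
    the list is increasing, so its head is no larger. *)
Lemma dist_le (x y : H) :
  is_true (if dist x y is Some d then d <= m else false) <-> within m x y.
Proof.
split.
  rewrite /dist; case E: [seq _ <- _ | _] => [|d s] //= dm.
  have : d \in [seq k <- iota 0 #|H| | walk k x y] by rewrite E mem_head.
  rewrite mem_filter /walk => /andP[/existsP[p /andP[xp /eqP py]] _].
  by exists p; split; rewrite // size_tuple.
case=> p0 [xp0 <-]; case: (shortenP xp0) => p xp Up sub_p p0m.
have pm : size p <= m.
  by apply: leq_trans p0m; apply: uniq_leq_size => //; have /andP[] := Up.
have pH : size p < #|H|.
  by rewrite -[X in X <= _]/(size (x :: p)) -(card_uniqP Up) max_card.
have : size p \in [seq k <- iota 0 #|H| | walk k x (last x p)].
  rewrite mem_filter mem_iota /= add0n pH andbT.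
  by apply/existsP; exists (in_tuple p); rewrite /= xp eqxx.
have : sorted ltn [seq k <- iota 0 #|H| | walk k x (last x p)].
  by apply: sorted_filter (iota_ltn_sorted _ _); apply: ltn_trans.
rewrite /dist; case: [seq _ <- _ | _] => //= d s /(order_path_min ltn_trans)/allP ds.
by rewrite inE => /predU1P[<- //|/ds dp]; apply: leq_trans pm; apply: ltnW.
Qed.

Lemma power_adjP (x y : H) : power_adj m x y <-> x != y /\ within m x y.
Proof.
by rewrite /power_adj; split=> [/andP[-> /dist_le]|[-> /dist_le]].
Qed.

Lemma within_sym l (x y : H) : within l x y -> within l y x.
Proof.
case=> p [xp <- pl]; exists (rev (belast x p)); split; last by rewrite size_rev size_belast.
  rewrite rev_path (eq_path (e' := @adj H)) // => u v; exact: adj_sym.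
by case: p {xp pl} => //= z s; rewrite rev_cons last_rcons.
Qed.

Lemma within_trans l1 l2 (x y z : H) :
  within l1 x y -> within l2 y z -> within (l1 + l2) x z.
Proof.
case=> p [xp <- pl] [q [yq <- ql]]; exists (p ++ q).
by rewrite cat_path xp yq last_cat size_cat leq_add.
Qed.

End Power.

(** * Bounds on the chromatic and clique numbers *)

Lemma leq_clique_chromatic (H : sgraph) : clique_number H <= chromatic_number H.
Proof.
rewrite /chromatic_number; case: ex_minnP => k /existsP[f /forallP fP] _.
apply/bigmax_leqP=> A /forall_inP AP.
rewrite -[k]card_ord -(card_in_imset (f := f) (D := A)) ?max_card // => x y xA yA fxy.
have /forall_inP/(_ y yA)/implyP xy := AP x xA.
apply/eqP/contraT=> /xy; have /forallP/(_ y)/implyP h := fP x.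
by move/h; rewrite fxy eqxx.
Qed.

Lemma chromatic_leq (H : sgraph) k : colorable H k -> chromatic_number H <= k.
Proof. by rewrite /chromatic_number; case: ex_minnP => j _; apply. Qed.

Lemma colorable_fractional_power (G : sgraph) k n D :
  0 < k -> k.*2 < n -> 3 < D -> (forall x : G, degree x <= D) ->
  colorable (fractional_power G k.*2 n) (D * k).+1.
Proof.
move=> k0 lt_kn D4 degD; have n0 : 0 < n by lia.
have [c cP c_half] := half_edge_coloring (ltnW (ltnW D4)) degD.
have /fin_all_exists[X XP] (e : edge G) : exists x, good_word k D n
    (c (val e).1 (val e).2) (c (val e).2 (val e).1) x.
  apply: good_word_exists => // /ord_inj/eqP; apply/negP/c_half.
  by have /andP[] := valP e.
pose f (v : subdivision G n) :=
  match v with inl _ => (0, 0) | inr (e, j) => X e (val j).+1 end.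
have f_path (e : edge G) i : i <= n -> f (path_vertex n e i) = X e i.
  have [[X0 _ _] [Xn _ _] _ _] := XP e; rewrite subn0 in Xn.
  by move=> ni; case: (path_vertexP n0 e ni) => [->|j ->|->].
have f_dart u v : adj u v ->
    good_word k D n (c u v) (c v u) (fun i => f (dart_vertex n u v i)).
  case/adj_edge=> e [[-> ->]|[-> ->]].
    by apply: eq_good_word (XP e) _ => // i ni; rewrite dart_vertexE f_path.
  by apply: rev_good_word (XP e) _ => // i ni; rewrite dart_vertexNE f_path //; lia.
have f_valid v : valid_color k D (f v).
  case: v => [u|[e j]] //=; have [_ _ Xv _] := XP e.
  by apply: Xv; have := ltn_ord j; lia.
have same_path u v i j : adj u v -> i <= n -> j <= n -> i <> j ->
    i <= j + k.*2 -> j <= i + k.*2 ->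
    f (dart_vertex n u v i) <> f (dart_vertex n u v j).
  move=> uv ni nj ij ij1 ij2; have [_ _ _ Xd] := f_dart _ _ uv.
  by case: (ltngtP i j) => // ij'; [apply: Xd; lia | apply/nesym/Xd; lia].
(* The second vertex has colour [(c u w, j)] with [c u w] different from [c u v], so the last clause
   of [starts_with] applies. *)
have crossing u v w i j : adj u v -> adj u w -> v <> w -> 0 < i -> 0 < j <= k ->
    i + j <= k.*2 -> f (dart_vertex n u v i) <> f (dart_vertex n u w j).
  move=> uv uw vw i0 /andP[j0 jk] ij.
  have [[_ _ Xf] _ _ _] := f_dart _ _ uv; have [[_ Xl _] _ _ _] := f_dart _ _ uw.
  rewrite Xl ?j0 //; apply: Xf => // /ord_inj cwv; apply: vw.
  by apply: (cP u).
have f_near l x y : l <= k.*2 -> x != y -> near l x y -> f x <> f y.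
  move=> lk xy [u [v [w [i [j [uv uw /andP[ni nj] [xE yE] ij]]]]]]; rewrite xE yE.
  have [vw|/eqP vw] := eqVneq v w.
    subst w; apply: same_path => //; try by case: ij; lia.
    by move=> eq_ij; rewrite xE yE eq_ij eqxx in xy.
  case: ij => [[/vw]|] // ij.
  (* A vertex at position 0 is [u], which lies on both paths, so [same_path] suffices. *)
  have [i0|i0] := posnP i.
    rewrite i0 dart_vertex0 // -(dart_vertex0 n0 uw); apply: same_path => //; try lia.
    by move=> j0; rewrite xE yE i0 -j0 !dart_vertex0 // eqxx in xy.
  have [j0|j0] := posnP j.
    by rewrite j0 dart_vertex0 // -(dart_vertex0 n0 uv); apply: same_path; rewrite //; lia.
  (* Since [i + j <= 2k], one of the positions is at most k. *)
  case: (leqP j k) => jk; first by apply: crossing => //; lia.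
  by apply/nesym/crossing => //; [apply/nesym | lia..].
apply/existsP; exists [ffun v => Ordinal (color_code_lt (f_valid v))].
apply/forallP=> x; apply/forallP=> y; apply/implyP=> /power_adjP[xy [p [xp py pk]]].
rewrite !ffunE; apply/eqP=> /(congr1 val) /= /(color_code_inj (f_valid x) (f_valid y)).
apply: (f_near (size p)) => //; rewrite -py; apply: near_path => //.
case: p xp py pk => [|z p] _ /= yE pk; last by lia.
by rewrite yE eqxx in xy.
Qed.

Lemma clique_fractional_power (G : sgraph) k n (v : G) : k.*2 < n ->
  (degree v * k).+1 <= clique_number (fractional_power G k.*2 n).
Proof.
move=> lt_kn; have n0 : 0 < n by lia.
pose dart (wi : G * 'I_k) : fractional_power G k.*2 n :=
  dart_vertex n v wi.1 wi.2.+1.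
pose S := setX [set w | adj v w] [set: 'I_k].
have inS w i : ((w, i) \in S) = adj v w by rewrite !inE andbT.
have dart_inj : {in S &, injective dart}.
  move=> [w i] [w' i']; rewrite !inS => vw vw' ww'.
  have i_in : 0 < i.+1 < n by have := ltn_ord i; lia.
  have i'n : i'.+1 <= n by have := ltn_ord i'; lia.
  have := dart_vertex_inner_inj n0 vw vw' i_in i'n ww'.
  (* The reversed orientation would make [v] adjacent to itself. *)
  case=> -[h1 h2 h3]; last by rewrite h1 adj_irrefl in vw.
  by congr pair; [| apply: ord_inj; lia].
have center w i : adj v w -> i <= k ->
    within (H := subdivision G n) k (inl v) (dart_vertex n v w i).
  move=> vw; rewrite -(dart_vertex0 n0 vw).
  have: within (H := subdivision G n) 0 (dart_vertex n v w 0) (dart_vertex n v w 0).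
    by exists [::].
  move=> w0 ik; suff: within (H := subdivision G n) i (dart_vertex n v w 0) (dart_vertex n v w i).
    by case=> p [? ? pi]; exists p; split=> //; apply: leq_trans ik.
  elim: i ik => [|i IH] ik //; rewrite -addn1; apply: within_trans (IH (ltnW ik)) _.
  rewrite addn1; exists [:: dart_vertex n v w i.+1]; split=> //=; rewrite andbT.
  by apply: dart_subdiv_adj => //; lia.
pose A := (inl v : fractional_power G k.*2 n) |: dart @: S.
have cardA : #|A| = (degree v * k).+1.
  rewrite cardsU1 card_in_imset // cardsX cardsT card_ord.
  suff -> : inl v \notin dart @: S by [].
  apply/imsetP=> -[[w i]]; rewrite inS => vw /esym /(dart_vertex_inl n0 vw).
  by have := ltn_ord i; case=> /=; lia.
rewrite -cardA; apply: (leq_bigmax_cond A (F := fun A : {set _} => #|A|)).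
have centerA x : x \in A -> within (H := subdivision G n) k (inl v) x.
  rewrite !inE => /predU1P[->|/imsetP[[w i]]]; first by exists [::].
  by rewrite inS => vw ->; apply: center.
apply/forall_inP=> x /centerA vx; apply/forall_inP=> y /centerA vy.
apply/implyP=> xy; apply/power_adjP; split=> //.
by rewrite -addnn; apply: within_trans vy; apply: within_sym.
Qed.

Theorem theorem3p1 (m n : nat) (G : sgraph)
  (m_gt0 : 0 < m) (n_gt0 : 0 < n) (lt_mn : m < n) (m_even : ~~ odd m)
  (G_connected : connected G) (G_max_degree : 4 <= max_degree G) :
  chromatic_number (fractional_power G m n)
  = clique_number (fractional_power G m n).
Proof.
have [v degv] : exists v : G, max_degree G = degree v.
  have [|v ?] := @eq_bigmax G (@degree G); last by exists v.
  (* The maximum is attained because a graph without vertices would have maximum degree 0. *)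
  rewrite lt0n; apply: contraTneq G_max_degree => /card0_eq G0.
  by rewrite /max_degree big_pred0.
have mE : m = m./2.*2 by rewrite -[LHS]odd_double_half (negbTE m_even).
apply/eqP; rewrite eqn_leq leq_clique_chromatic andbT mE.
apply: (@leq_trans (max_degree G * m./2).+1).
  apply/chromatic_leq/colorable_fractional_power; rewrite -?mE //; first lia.
  by move=> x; apply: leq_bigmax.
by rewrite degv; apply: clique_fractional_power; rewrite -mE.
Qed.
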